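(* Consider the output-feedback system $x[t+1]=Ax[t]+B_2u[t]+\delta_x[t]$, $y[t]=C_2x[t]+\delta_y[t]$ with control law $\mathbf{u}=\mathbf{K}\mathbf{y}$. The following are true. (a) The affine subspace described by $$\begin{bmatrix} zI-A & -B_2\end{bmatrix}\begin{bmatrix}\mathbf{\Phi}_{xx}&\mathbf{\Phi}_{xy}\\ \mathbf{\Phi}_{ux}&\mathbf{\Phi}_{uy}\end{bmatrix}=\begin{bmatrix}I&0\end{bmatrix},\qquad \begin{bmatrix}\mathbf{\Phi}_{xx}&\mathbf{\Phi}_{xy}\\ \mathbf{\Phi}_{ux}&\mathbf{\Phi}_{uy}\end{bmatrix}\begin{bmatrix}zI-A\\-C_2\end{bmatrix}=\begin{bmatrix}I\\0\end{bmatrix},$$ $$\mathbf{\Phi}_{xx},\mathbf{\Phi}_{ux},\mathbf{\Phi}_{xy}\in\tfrac1z\mathcal{RH}_\infty,\qquad\mathbf{\Phi}_{uy}\in\mathcal{RH}_\infty$$ parameterizes all system responses $$\mathbf{\Phi}_{xx}=(zI-A-B_2\mathbf{K}C_2)^{-1},\quad\mathbf{\Phi}_{ux}=\mathbf{K}C_2\mathbf{\Phi}_{xx},\quad\mathbf{\Phi}_{xy}=\mathbf{\Phi}_{xx}B_2\mathbf{K},\quad\mathbf{\Phi}_{uy}=\mathbf{K}+\mathbf{K}C_2\mathbf{\Phi}_{xx}B_2\mathbf{K}$$ achievable by an internally stabilizing controller $\mathbf{K}$; that is, a quadruple of transfer matrices lies in this affine subspace if and only if it is the system response achieved by some internally stabilizing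 $\mathbf{K}$. (b) For any transfer matrices $\{\mathbf{\Phi}_{xx},\mathbf{\Phi}_{ux},\mathbf{\Phi}_{xy},\mathbf{\Phi}_{uy}\}$ in this affine subspace, the controller $\mathbf{K}=\mathbf{\Phi}_{uy}-\mathbf{\Phi}_{ux}\mathbf{\Phi}_{xx}^{-1}\mathbf{\Phi}_{xy}$ achieves the desired response (i.e. the four displayed relations between the responses and $\mathbf{K}$ hold). Further, if the controller is implemented as $$z\boldsymbol{\beta}=\tilde{\mathbf{\Phi}}_{xx}\boldsymbol{\beta}+\tilde{\mathbf{\Phi}}_{xy}\mathbf{y},\qquad\mathbf{u}=\tilde{\mathbf{\Phi}}_{ux}\boldsymbol{\beta}+\mathbf{\Phi}_{uy}\mathbf{y},$$ with $\tilde{\mathbf{\Phi}}_{xx}=z(I-z\mathbf{\Phi}_{xx})$, $\tilde{\mathbf{\Phi}}_{ux}=z\mathbf{\Phi}_{ux}$, $\tilde{\mathbf{\Phi}}_{xy}=-z\mathbf{\Phi}_{xy}$, then it is internally stabilizing.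
   Context: Here $x,u,y$ are state, control input and measurement, $\delta_x,\delta_y$ disturbances on the state and on the measurement, and $A,B_2,C_2$ real matrices of compatible dimensions (the plant from $u$ to $y$ is strictly proper). Boldface denotes $z$-transforms of signals and transfer matrices. $\mathcal{RH}_\infty$ is the set of stable (all poles in $|z|<1$) real-rational proper transfer matrices; $\mathbf{G}\in\frac1z\mathcal{RH}_\infty$ means $z\mathbf{G}\in\mathcal{RH}_\infty$. The system response $\{\mathbf{\Phi}_{xx},\mathbf{\Phi}_{ux},\mathbf{\Phi}_{xy},\mathbf{\Phi}_{uy}\}$ is defined by $\mathbf{x}=\mathbf{\Phi}_{xx}\boldsymbol{\delta}_x+\mathbf{\Phi}_{xy}\boldsymbol{\delta}_y$, $\mathbf{u}=\mathbf{\Phi}_{ux}\boldsymbol{\delta}_x+\mathbf{\Phi}_{uy}\boldsymbol{\delta}_y$. Controllers $\mathbf{K}$ are proper real-rational transfer matrices with a stabilizable and detectable state-space realization $(A_k,B_k,C_k,D_k)$, and $\mathbf{K}$ is internally stabilizing if the closed-loop state matrix $\begin{bmatrix}A+B_2D_kC_2 & B_2C_k \\ B_kC_2 & A_k\end{bmatrix}$ has all eigenvalues in $|z|<1$. Internal stability of the implementation in (b), with internal controller signal $\boldsymbol{\beta}$, means: with external perturbations $\boldsymbol{\delta}_x,\boldsymbol{\delta}_y,\boldsymbol{\delta}_u,\boldsymbol{\delta}_\beta$ entering as $$z\mathbf{x}=A\mathbf{x}+B_2\mathbf{u}+\boldsymbol{\delta}_x,\quad\mathbf{y}=C_2\mathbf{x}+\boldsymbol{\delta}_y,\quad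 z\boldsymbol{\beta}=\tilde{\mathbf{\Phi}}_{xx}\boldsymbol{\beta}+\tilde{\mathbf{\Phi}}_{xy}\mathbf{y}+\boldsymbol{\delta}_\beta,\quad\mathbf{u}=\tilde{\mathbf{\Phi}}_{ux}\boldsymbol{\beta}+\mathbf{\Phi}_{uy}\mathbf{y}+\boldsymbol{\delta}_u,$$ all sixteen closed-loop transfer matrices from $(\boldsymbol{\delta}_x,\boldsymbol{\delta}_y,\boldsymbol{\delta}_u,\boldsymbol{\delta}_\beta)$ to $(\mathbf{x},\mathbf{u},\mathbf{y},\boldsymbol{\beta})$ belong to $\mathcal{RH}_\infty$. *)

(* Defs.v *)
From HB Require Import structures.
From mathcomp Require Import all_boot all_order all_algebra.
From mathcomp Require Import reals complex.

Set Implicit Arguments.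
Unset Strict Implicit.
Unset Printing Implicit Defensive.
Import Order.TTheory GRing.Theory Num.Theory.
Local Open Scope ring_scope.

(** Transfer functions are elements of the field R(z), with z = 'X. *)
Notation ratfun R := {fraction {poly R}}.

Definition zvar (R : realType) : ratfun R := tofrac 'X.

Definition constmx (R : realType) (m n : nat) (M : 'M[R]_(m, n)) :
  'M[ratfun R]_(m, n) := map_mx (fun c : R => tofrac c%:P) M.

(** The matrix zI - A. *)
Definition zsub (R : realType) (n : nat) (A : 'M[R]_n) : 'M[ratfun R]_n :=
  (zvar R)%:M - constmx A.

(** Poles are read off a reduced fraction, so cancelled roots do not count. *)
Definition pole (R : realType) (g : ratfun R) (s : complex R) : Prop :=
  exists p q : {poly R},
    [/\ q != 0, coprimep p q, g = tofrac p / tofrac q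
      & root (map_poly (real_complex R) q) s].

(** [size] is degree + 1 (0 for the zero polynomial), so this is deg p <= deg q. *)
Definition proper (R : realType) (g : ratfun R) : Prop :=
  exists p q : {poly R},
    [/\ q != 0, g = tofrac p / tofrac q & (size p <= size q)%N].

Definition RHinf (R : realType) (g : ratfun R) : Prop :=
  proper g /\ forall s : complex R, pole g s -> `|s| < 1.

Definition proper_mx (R : realType) (m n : nat) (G : 'M[ratfun R]_(m, n)) :
  Prop := forall i j, proper (G i j).

Definition RHinf_mx (R : realType) (m n : nat) (G : 'M[ratfun R]_(m, n)) :
  Prop := forall i j, RHinf (G i j).

(** G \in (1/z) RH_oo. *)
Definition zRHinf_mx (R : realType) (m n : nat) (G : 'M[ratfun R]_(m, n)) :
  Prop := RHinf_mx (zvar R *: G).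

Definition schur (R : realType) (n : nat) (A : 'M[R]_n) : Prop :=
  forall s : complex R,
    eigenvalue (map_mx (real_complex R) A) s -> `|s| < 1.

Definition stabilizable (R : realType) (n m : nat)
    (A : 'M[R]_n) (B : 'M[R]_(n, m)) : Prop :=
  exists F : 'M[R]_(m, n), schur (A + B *m F).

Definition detectable (R : realType) (n p : nat)
    (A : 'M[R]_n) (C : 'M[R]_(p, n)) : Prop :=
  exists L : 'M[R]_(n, p), schur (A + L *m C).

(** K = C_k (zI - A_k)^-1 B_k + D_k; zI - A_k is always invertible over R(z). *)
Definition realizes (R : realType) (k m p : nat)
    (Ak : 'M[R]_k) (Bk : 'M[R]_(k, p)) (Ck : 'M[R]_(m, k)) (Dk : 'M[R]_(m, p))
    (K : 'M[ratfun R]_(m, p)) : Prop :=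
  K = constmx Ck *m invmx (zsub Ak) *m constmx Bk + constmx Dk.

Definition controller_realization (R : realType) (k m p : nat)
    (Ak : 'M[R]_k) (Bk : 'M[R]_(k, p)) (Ck : 'M[R]_(m, k)) (Dk : 'M[R]_(m, p))
    (K : 'M[ratfun R]_(m, p)) : Prop :=
  [/\ realizes Ak Bk Ck Dk K, stabilizable Ak Bk & detectable Ak Ck].

Definition controller (R : realType) (m p : nat) (K : 'M[ratfun R]_(m, p)) :
  Prop :=
  proper_mx K /\
  exists (k : nat) (Ak : 'M[R]_k) (Bk : 'M[R]_(k, p)) (Ck : 'M[R]_(m, k))
         (Dk : 'M[R]_(m, p)), controller_realization Ak Bk Ck Dk K.

Definition closed_loop_mx (R : realType) (n m p k : nat)
    (A : 'M[R]_n) (B2 : 'M[R]_(n, m)) (C2 : 'M[R]_(p, n))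
    (Ak : 'M[R]_k) (Bk : 'M[R]_(k, p)) (Ck : 'M[R]_(m, k)) (Dk : 'M[R]_(m, p)) :
  'M[R]_(n + k) :=
  block_mx (A + B2 *m Dk *m C2) (B2 *m Ck)
           (Bk *m C2)           Ak.

Definition internally_stabilizing (R : realType) (n m p : nat)
    (A : 'M[R]_n) (B2 : 'M[R]_(n, m)) (C2 : 'M[R]_(p, n))
    (K : 'M[ratfun R]_(m, p)) : Prop :=
  proper_mx K /\
  exists (k : nat) (Ak : 'M[R]_k) (Bk : 'M[R]_(k, p)) (Ck : 'M[R]_(m, k))
         (Dk : 'M[R]_(m, p)),
    controller_realization Ak Bk Ck Dk K
    /\ schur (closed_loop_mx A B2 C2 Ak Bk Ck Dk).

(** [invmx] returns its argument on a singular matrix, hence the explicit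
    invertibility conjunct. *)
Definition achieves (R : realType) (n m p : nat)
    (A : 'M[R]_n) (B2 : 'M[R]_(n, m)) (C2 : 'M[R]_(p, n))
    (K : 'M[ratfun R]_(m, p))
    (Pxx : 'M[ratfun R]_n) (Pux : 'M[ratfun R]_(m, n))
    (Pxy : 'M[ratfun R]_(n, p)) (Puy : 'M[ratfun R]_(m, p)) : Prop :=
  let L := zsub A - constmx B2 *m K *m constmx C2 in
  [/\ L \in unitmx /\ Pxx = invmx L,
      Pux = K *m constmx C2 *m Pxx,
      Pxy = Pxx *m constmx B2 *m K
    & Puy = K + K *m constmx C2 *m Pxx *m constmx B2 *m K].

Definition in_affine_subspace (R : realType) (n m p : nat)
    (A : 'M[R]_n) (B2 : 'M[R]_(n, m)) (C2 : 'M[R]_(p, n))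
    (Pxx : 'M[ratfun R]_n) (Pux : 'M[ratfun R]_(m, n))
    (Pxy : 'M[ratfun R]_(n, p)) (Puy : 'M[ratfun R]_(m, p)) : Prop :=
  [/\ row_mx (zsub A) (- constmx B2) *m block_mx Pxx Pxy Pux Puy
        = row_mx 1%:M 0,
      block_mx Pxx Pxy Pux Puy *m col_mx (zsub A) (- constmx C2)
        = col_mx 1%:M 0,
      [/\ zRHinf_mx Pxx, zRHinf_mx Pux & zRHinf_mx Pxy]
    & RHinf_mx Puy].

(** z-domain equations of the plant in feedback with an implementation
    z beta = Txx beta + Txy y,  u = Tux beta + Tuy y,  perturbed by
    dx, dy, du, db. *)
Definition implementation_eqs (R : realType) (n m p : nat)
    (A : 'M[R]_n) (B2 : 'M[R]_(n, m)) (C2 : 'M[R]_(p, n))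
    (Txx : 'M[ratfun R]_n) (Tux : 'M[ratfun R]_(m, n))
    (Txy : 'M[ratfun R]_(n, p)) (Tuy : 'M[ratfun R]_(m, p))
    (dx : 'cV[ratfun R]_n) (dy : 'cV[ratfun R]_p)
    (du : 'cV[ratfun R]_m) (db : 'cV[ratfun R]_n)
    (x : 'cV[ratfun R]_n) (u : 'cV[ratfun R]_m)
    (y : 'cV[ratfun R]_p) (b : 'cV[ratfun R]_n) : Prop :=
  [/\ zvar R *: x = constmx A *m x + constmx B2 *m u + dx,
      y = constmx C2 *m x + dy,
      zvar R *: b = Txx *m b + Txy *m y + db
    & u = Tux *m b + Tuy *m y + du].

(** The 4 x 4 block matrix H collects the sixteen closed-loop transfer matrices
    from (dx, dy, du, db) to (x, u, y, b).  The equivalence says that the loop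
    is well posed: each perturbation determines the signals, and does so
    through H. *)
Definition implementation_internally_stable (R : realType) (n m p : nat)
    (A : 'M[R]_n) (B2 : 'M[R]_(n, m)) (C2 : 'M[R]_(p, n))
    (Txx : 'M[ratfun R]_n) (Tux : 'M[ratfun R]_(m, n))
    (Txy : 'M[ratfun R]_(n, p)) (Tuy : 'M[ratfun R]_(m, p)) : Prop :=
  exists H : 'M[ratfun R]_(n + (m + (p + n)), n + (p + (m + n))),
    (forall dx dy du db x u y b,
        implementation_eqs A B2 C2 Txx Tux Txy Tuy dx dy du db x u y b <->
        col_mx x (col_mx u (col_mx y b))
          = H *m col_mx dx (col_mx dy (col_mx du db)))
    /\ RHinf_mx H.

(* Main.v *)
(** The four identities of the affine subspace give
    [zI - A - B2 K C2 = Pxx^-1] for [K = Puy - Pux Pxx^-1 Pxy], hence the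
    responses achieved by [K].  Since [z Pxx = I + A Pxx + B2 Pux] has a
    realization with invertible feedthrough [I], both [(z Pxx)^-1] and [K] are
    realizable, and a realization that cannot be shrunk is stabilizable and
    detectable.  With a static feedback F and an injection L stabilizing the
    controller, every block of the resolvent of the closed-loop state matrix
    is a polynomial expression in the given responses and in the stable
    resolvents of [Ak + Bk F] and [Ak + L Ck]; a matrix whose resolvent is
    stable is Schur.  Conversely the responses are read off the resolvent of
    the closed loop.  For the implementation in (b) the loop equations are
    solved explicitly; all closed-loop maps are polynomial in the responses,
    the data and [1/z]. *)

Require Import Defs.
From HB Require Import structures.
From mathcomp Require Import all_boot all_order all_algebra.
From mathcomp Require Import reals complex.
From mathcomp Require Import perm zify.
Import Order.TTheory GRing.Theory Num.Theory.
Set Implicit Arguments.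
Unset Strict Implicit.
Unset Printing Implicit Defensive.
Local Open Scope ring_scope.

(** * Proper and stable rational functions *)

Section StableRationalFunctions.
Variable R : realType.
Implicit Types (p q : {poly R}) (f g : ratfun R).

Definition stable_poly (q : {poly R}) : Prop :=
  forall s : complex R, root (map_poly (real_complex R) q) s -> `|s| < 1.

Lemma stable_polyM p q : stable_poly p -> stable_poly q -> stable_poly (p * q).
Proof.
by move=> sp sq s; rewrite rmorphM rootM => /orP[/sp|/sq].
Qed.

Lemma stable_poly_dvd p q : p %| q -> stable_poly q -> stable_poly p.
Proof.
move=> pq sq s ps; apply: sq; apply: root_dvdp ps.
by rewrite dvdp_map.
Qed.

Lemma tofrac_neq0 q : q != 0 -> tofrac q != 0 :> ratfun R.
Proof. by rewrite tofrac_eq0. Qed.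

Lemma stable_poly1 : stable_poly 1.
Proof. by move=> s; rewrite rmorph1 rootC oner_eq0. Qed.

(** The fraction need not be reduced. A multiplicative [S] lets one closure proof serve properness
    ([S] trivial) and stability alike. *)
Definition proper_over (S : {poly R} -> Prop) g : Prop :=
  exists p q, [/\ q != 0, g = tofrac p / tofrac q, (size p <= size q)%N & S q].

(** Cancelling the gcd turns every root of the denominator into a pole. Conversely, by Gauss's lemma
    a reduced denominator divides any other denominator of the same fraction, so each pole is a root
    of it. *)
Lemma RHinfP g : RHinf g <-> proper_over stable_poly g.
Proof.
split=> [[[p [q [q0 -> spq]]] stab]|[p [q [q0 -> spq sq]]]].
- have d0 : gcdp p q != 0 by rewrite gcdp_eq0 negb_and q0 orbT.
  set d := gcdp p q in d0; set p' := p %/ d; set q' := q %/ d.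
  have pE : p = p' * d by rewrite divpK ?dvdp_gcdl.
  have qE : q = q' * d by rewrite divpK ?dvdp_gcdr.
  have q'0 : q' != 0 by apply: contraNneq q0 => z; rewrite qE z mul0r.
  have gE : tofrac p / tofrac q = tofrac p' / tofrac q' :> ratfun R.
    rewrite pE qE !rmorphM /= invfM mulrACA divff ?mulr1 ?tofrac_neq0 //.
  exists p', q'; split=> //.
    have [->|p'0] := eqVneq p' 0; first by rewrite size_poly0.
    move: spq; rewrite pE qE !size_mul //.
    have := size_poly_gt0 d; rewrite d0.
    case: (size d) => // k _; rewrite !addnS /= leq_add2r.
    by [].
  move=> s qs; apply: stab; exists p', q'; split=> //.
  by rewrite coprimep_div_gcd // q0 orbT.
- split; first by exists p, q.
  move=> s [p0 [q1 [q10 cop E rs]]]; apply: sq; apply: root_dvdp rs.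
  move: cop; rewrite dvdp_map coprimep_sym => /(Gauss_dvdpr q) <-.
  suff -> : p0 * q = p * q1 by rewrite dvdp_mull.
  apply/eqP; rewrite -(tofrac_eq (R := {poly R})) !rmorphM /=.
  by rewrite -eqr_div ?tofrac_neq0 // E.
Qed.

Section ProperFractions.
Variable S : {poly R} -> Prop.
Hypothesis S1 : S 1.
Hypothesis SM : forall p q, S p -> S q -> S (p * q).

Lemma proper_overC (c : R) : proper_over S (tofrac c%:P : ratfun R).
Proof.
exists c%:P, 1; split; rewrite ?oner_eq0 //; first by rewrite rmorph1 divr1.
by rewrite size_polyC size_poly1 leq_b1.
Qed.

Lemma proper_overM f g : proper_over S f -> proper_over S g -> proper_over S (f * g).
Proof.
move=> [p [q [q0 -> spq sq]]] [p' [q' [q'0 -> spq' sq']]].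
exists (p * p'), (q * q'); split; last exact: SM.
- by rewrite mulf_neq0.
- by rewrite !rmorphM /= invfM mulrACA.
- apply: leq_trans (size_polyMleq _ _) _.
  by rewrite size_mul // -!subn1 leq_sub2r // leq_add.
Qed.

Lemma proper_overD f g : proper_over S f -> proper_over S g -> proper_over S (f + g).
Proof.
move=> [p [q [q0 -> spq sq]]] [p' [q' [q'0 -> spq' sq']]].
exists (p * q' + p' * q), (q * q'); split; last exact: SM.
- by rewrite mulf_neq0.
- by rewrite addf_div ?tofrac_neq0 // !(rmorphD, rmorphM).
- apply: leq_trans (size_polyD _ _) _; rewrite geq_max (size_mul q0 q'0).
  apply/andP; split; apply: leq_trans (size_polyMleq _ _) _;
    rewrite -!subn1 leq_sub2r //; last by rewrite addnC leq_add2l.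
  by rewrite leq_add2r.
Qed.

End ProperFractions.

Lemma properP g : Defs.proper g <-> proper_over (fun=> True) g.
Proof. by split=> [[p [q []]]|[p [q []]]]; exists p, q. Qed.

Lemma properC (c : R) : Defs.proper (tofrac c%:P : ratfun R).
Proof. exact/properP/proper_overC. Qed.

Lemma properM f g : Defs.proper f -> Defs.proper g -> Defs.proper (f * g).
Proof. by move=> /properP Hf /properP Hg; apply/properP/proper_overM. Qed.

Lemma properD f g : Defs.proper f -> Defs.proper g -> Defs.proper (f + g).
Proof. by move=> /properP Hf /properP Hg; apply/properP/proper_overD. Qed.

Lemma proper_mxM a b c (F : 'M[ratfun R]_(a, b)) (G : 'M[ratfun R]_(b, c)) :
  proper_mx F -> proper_mx G -> proper_mx (F *m G).
Proof.
move=> HF HG i j; rewrite mxE; apply: big_ind => [||k _]; last exact: properM.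
  by have := properC 0; rewrite !rmorph0.
exact: properD.
Qed.

Lemma proper_mxD a b (F G : 'M[ratfun R]_(a, b)) :
  proper_mx F -> proper_mx G -> proper_mx (F + G).
Proof. by move=> HF HG i j; rewrite mxE; apply: properD. Qed.

Lemma proper_constmx a b (M : 'M[R]_(a, b)) : proper_mx (constmx M).
Proof. by move=> i j; rewrite mxE; apply: properC. Qed.

Lemma RHinfC (c : R) : RHinf (tofrac c%:P : ratfun R).
Proof. exact/RHinfP/proper_overC/stable_poly1. Qed.

Lemma RHinf0 : RHinf (0 : ratfun R).
Proof. by have := RHinfC 0; rewrite !rmorph0. Qed.

Lemma RHinf_zinv : RHinf ((zvar R)^-1).
Proof.
apply/RHinfP; exists 1, 'X; split; rewrite ?polyX_eq0 //.
- by rewrite rmorph1 div1r.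
- by rewrite size_poly1 size_polyX.
- by move=> s; rewrite map_polyX rootX => /eqP->; rewrite normr0 ltr01.
Qed.

Lemma RHinfM f g : RHinf f -> RHinf g -> RHinf (f * g).
Proof.
by move=> /RHinfP Hf /RHinfP Hg; apply/RHinfP/proper_overM => //; apply: stable_polyM.
Qed.

Lemma RHinfD f g : RHinf f -> RHinf g -> RHinf (f + g).
Proof.
by move=> /RHinfP Hf /RHinfP Hg; apply/RHinfP/proper_overD => //; apply: stable_polyM.
Qed.

Lemma RHinfN f : RHinf f -> RHinf (- f).
Proof.
move=> Hf; rewrite -mulN1r; apply: RHinfM => //.
by have := RHinfC (-1); rewrite polyCN !rmorphN !rmorph1.
Qed.

Lemma RHinf1 : RHinf (1 : ratfun R).
Proof. by have := RHinfC 1; rewrite !rmorph1. Qed.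

Lemma RHinf_sum (I : Type) (r : seq I) (P : pred I) (F : I -> ratfun R) :
  (forall i, P i -> RHinf (F i)) -> RHinf (\sum_(i <- r | P i) F i).
Proof. by move=> FP; apply: big_ind => //; [exact: RHinf0|exact: RHinfD]. Qed.

Lemma RHinf_prod (I : Type) (r : seq I) (P : pred I) (F : I -> ratfun R) :
  (forall i, P i -> RHinf (F i)) -> RHinf (\prod_(i <- r | P i) F i).
Proof. by move=> FP; apply: big_ind => //; [exact: RHinf1|exact: RHinfM]. Qed.

Lemma RHinf_mxM a b c (F : 'M[ratfun R]_(a, b)) (G : 'M[ratfun R]_(b, c)) :
  RHinf_mx F -> RHinf_mx G -> RHinf_mx (F *m G).
Proof. by move=> HF HG i j; rewrite mxE; apply: RHinf_sum => k _; apply: RHinfM. Qed.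

Lemma RHinf_mxD a b (F G : 'M[ratfun R]_(a, b)) :
  RHinf_mx F -> RHinf_mx G -> RHinf_mx (F + G).
Proof. by move=> HF HG i j; rewrite mxE; apply: RHinfD. Qed.

Lemma RHinf_mxN a b (F : 'M[ratfun R]_(a, b)) : RHinf_mx F -> RHinf_mx (- F).
Proof. by move=> HF i j; rewrite mxE; apply: RHinfN. Qed.

Lemma RHinf_mxB a b (F G : 'M[ratfun R]_(a, b)) :
  RHinf_mx F -> RHinf_mx G -> RHinf_mx (F - G).
Proof. by move=> HF HG; apply: RHinf_mxD => //; apply: RHinf_mxN. Qed.

Lemma RHinf_mxZ a b g (F : 'M[ratfun R]_(a, b)) :
  RHinf g -> RHinf_mx F -> RHinf_mx (g *: F).
Proof. by move=> Hg HF i j; rewrite mxE; apply: RHinfM. Qed.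

Lemma RHinf_constmx a b (M : 'M[R]_(a, b)) : RHinf_mx (constmx M).
Proof. by move=> i j; rewrite mxE; apply: RHinfC. Qed.

Lemma RHinf_row_mx a b c (F : 'M[ratfun R]_(a, b)) (G : 'M[ratfun R]_(a, c)) :
  RHinf_mx F -> RHinf_mx G -> RHinf_mx (row_mx F G).
Proof. by move=> HF HG i j; rewrite mxE; case: split. Qed.

Lemma RHinf_col_mx a b c (F : 'M[ratfun R]_(a, c)) (G : 'M[ratfun R]_(b, c)) :
  RHinf_mx F -> RHinf_mx G -> RHinf_mx (col_mx F G).
Proof. by move=> HF HG i j; rewrite mxE; case: split. Qed.

Lemma RHinf_scalar_mx a g : RHinf g -> RHinf_mx (g%:M : 'M_a).
Proof. by move=> Hg i j; rewrite mxE; case: eqP => // _; apply: RHinf0. Qed.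

Lemma RHinf_det a (F : 'M[ratfun R]_a) : RHinf_mx F -> RHinf (\det F).
Proof.
move=> HF; apply: RHinf_sum => s _; apply: RHinfM; last exact: RHinf_prod.
by case: (odd_perm s); rewrite ?expr1 ?expr0; [apply: RHinfN|]; apply: RHinf1.
Qed.

Lemma zvar_neq0 : zvar R != 0.
Proof. by rewrite tofrac_neq0 ?polyX_eq0. Qed.

Lemma zRHinf_mxW a b (F : 'M[ratfun R]_(a, b)) : zRHinf_mx F -> RHinf_mx F.
Proof.
move=> /(RHinf_mxZ RHinf_zinv).
by rewrite scalerA mulVf ?zvar_neq0 ?scale1r.
Qed.

Lemma zRHinf_mxM a b c (F : 'M[ratfun R]_(a, b)) (G : 'M[ratfun R]_(b, c)) :
  zRHinf_mx F -> RHinf_mx G -> zRHinf_mx (F *m G).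
Proof. by move=> HF HG; rewrite /zRHinf_mx scalemxAl; apply: RHinf_mxM. Qed.

Lemma zRHinf_mxMr a b c (F : 'M[ratfun R]_(a, b)) (G : 'M[ratfun R]_(b, c)) :
  RHinf_mx F -> zRHinf_mx G -> zRHinf_mx (F *m G).
Proof. by move=> HF HG; rewrite /zRHinf_mx scalemxAr; apply: RHinf_mxM. Qed.

End StableRationalFunctions.

(** * Resolvents and Schur matrices *)

Section ConstantMatrices.
Variable R : realType.

(** Named so that it carries a ring morphism structure, which makes the [map_mx] lemmas apply to
    [constmx]. *)
Definition constfun : R -> ratfun R := @tofrac {poly R} \o polyC.
HB.instance Definition _ := GRing.RMorphism.on constfun.

Lemma constmxE a b (M : 'M[R]_(a, b)) : constmx M = map_mx constfun M.
Proof. by []. Qed.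

Lemma constmxM a b c (M : 'M[R]_(a, b)) (N : 'M[R]_(b, c)) :
  constmx (M *m N) = constmx M *m constmx N.
Proof. by rewrite !constmxE map_mxM. Qed.

Lemma constmxD a b (M N : 'M[R]_(a, b)) : constmx (M + N) = constmx M + constmx N.
Proof. by rewrite !constmxE map_mxD. Qed.

Lemma constmxN a b (M : 'M[R]_(a, b)) : constmx (- M) = - constmx M.
Proof. by rewrite !constmxE map_mxN. Qed.

Lemma constmx0 a b : constmx (0 : 'M[R]_(a, b)) = 0.
Proof. by rewrite constmxE map_mx0. Qed.

Lemma constmx1 a : constmx (1%:M : 'M[R]_a) = 1%:M.
Proof. by rewrite constmxE map_mx1. Qed.

Lemma constmx_block a b c d (M : 'M[R]_(a, c)) (N : 'M[R]_(a, d))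
    (P : 'M[R]_(b, c)) (Q : 'M[R]_(b, d)) :
  constmx (block_mx M N P Q)
    = block_mx (constmx M) (constmx N) (constmx P) (constmx Q).
Proof. exact: map_block_mx. Qed.

Lemma constmx_row a b c (M : 'M[R]_(a, b)) (N : 'M[R]_(a, c)) :
  constmx (row_mx M N) = row_mx (constmx M) (constmx N).
Proof. exact: map_row_mx. Qed.

Lemma constmx_col a b c (M : 'M[R]_(a, c)) (N : 'M[R]_(b, c)) :
  constmx (col_mx M N) = col_mx (constmx M) (constmx N).
Proof. exact: map_col_mx. Qed.

Lemma constmx_tr a b (M : 'M[R]_(a, b)) : constmx M^T = (constmx M)^T.
Proof. by rewrite constmxE map_trmx. Qed.

Lemma zsub_block a b (M : 'M[R]_a) (N : 'M[R]_(a, b))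
    (P : 'M[R]_(b, a)) (Q : 'M[R]_b) :
  zsub (block_mx M N P Q)
    = block_mx (zsub M) (- constmx N) (- constmx P) (zsub Q).
Proof.
by rewrite /zsub scalar_mx_block constmx_block opp_block_mx add_block_mx !sub0r.
Qed.

Lemma zsubE a (M : 'M[R]_a) : zsub M = map_mx (@tofrac {poly R}) (char_poly_mx M).
Proof.
rewrite /zsub /char_poly_mx map_mxB map_scalar_mx /=; congr (_ - _).
by apply/matrixP => i j; rewrite !mxE.
Qed.

Lemma zsub_tr a (M : 'M[R]_a) : zsub M^T = (zsub M)^T.
Proof. by rewrite /zsub constmx_tr linearB /= tr_scalar_mx. Qed.

Lemma det_zsub a (M : 'M[R]_a) : \det (zsub M) = tofrac (char_poly M).
Proof. by rewrite zsubE det_map_mx. Qed.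

Lemma zsub_unit a (M : 'M[R]_a) : zsub M \in unitmx.
Proof.
by rewrite unitmxE det_zsub unitfE tofrac_neq0 // monic_neq0 // char_poly_monic.
Qed.

Lemma schurE a (M : 'M[R]_a) : schur M <-> stable_poly (char_poly M).
Proof.
by split=> H s; have := H s; rewrite eigenvalue_root_char map_char_poly.
Qed.

Lemma schur_tr a (M : 'M[R]_a) : schur M -> schur M^T.
Proof.
move=> /schurE H; apply/schurE; suff -> : char_poly M^T = char_poly M by [].
apply/eqP; rewrite -(tofrac_eq (R := {poly R})) -!det_zsub zsub_tr det_tr.
by [].
Qed.

(** Each term of the Leibniz expansion is, up to sign, a product of [a] polynomials of degree at
    most 1. *)
Lemma size_det_linear a (M : 'M[{poly R}]_a) :
  (forall i j, (size (M i j) <= 2)%N) -> (size (\det M) <= a.+1)%N.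
Proof.
move=> HM; apply: (big_ind (fun q : {poly R} => (size q <= a.+1)%N)).
- by rewrite size_poly0.
- by move=> p q Hp Hq; rewrite (leq_trans (size_polyD _ _)) // geq_max Hp.
move=> s _; rewrite mulr_sign (fun_if (fun q : {poly R} => size q)).
rewrite size_polyN if_same.
apply: leq_trans (size_poly_prod_leq _ _) _.
rewrite cardT size_enum_ord.
have : (\sum_i size (M i (s i)) <= \sum_(i < a) 2)%N by apply: leq_sum.
rewrite sum_nat_const card_ord => H.
by rewrite leq_subLR addnS ltnS (leq_trans H) // muln2 addnn.
Qed.

(** Cramer's rule: the numerator is a cofactor, a determinant of order one less than that of [M],
    hence the strict inequality. *)
Lemma resolvent_entry a (M : 'M[R]_a) i j : exists p,
  invmx (zsub M) i j = tofrac p / tofrac (char_poly M)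
  /\ (size p < size (char_poly M))%N.
Proof.
exists (\adj (char_poly_mx M) i j); split.
  rewrite /invmx zsub_unit det_zsub mxE zsubE -map_mx_adj mxE mulrC.
  by [].
rewrite size_char_poly ltnS mxE.
case: a M i j => [|a] M i j; first by case: i.
set S := cofactor _ _ _.
have -> : size S = size (\det (row' j (col' i (char_poly_mx M)))).
  rewrite /S /cofactor -signr_odd mulr_sign (fun_if (fun q : {poly R} => size q)).
  by rewrite size_polyN if_same.
apply: size_det_linear => k l; rewrite !mxE.
apply: leq_trans (size_polyD _ _) _; rewrite geq_max size_polyN size_polyC.
case: eqP => _; rewrite ?mulr1n ?mulr0n ?size_polyX ?size_poly0.
  by case: eqP.
by case: eqP.
Qed.

(** The strict degree bound in [resolvent_entry] leaves room for the extra factor [z]. *)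
Lemma schur_resolvent a (M : 'M[R]_a) : schur M -> zRHinf_mx (invmx (zsub M)).
Proof.
move=> /schurE st i j; have [p [E sp]] := resolvent_entry M i j.
rewrite mxE E; apply/RHinfP; exists ('X * p), (char_poly M); split=> //.
- by rewrite monic_neq0 ?char_poly_monic.
- by rewrite rmorphM /= mulrA.
- have [->|p0] := eqVneq p 0; first by rewrite mulr0 size_poly0.
  by rewrite mulrC size_mulX.
Qed.

(** Entrywise cancellations cannot hide an eigenvalue: [\det G] is the inverse of [char_poly M], so
    [char_poly M] divides a stable denominator of [\det G]. *)
Lemma resolvent_schur a (M : 'M[R]_a) G : zsub M *m G = 1%:M -> RHinf_mx G -> schur M.
Proof.
move=> MG /RHinf_det /RHinfP[p [q [q0 dG _ sq]]].
apply/schurE; apply: stable_poly_dvd sq.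
suff -> : q = char_poly M * p by rewrite dvdp_mulr.
apply/eqP; rewrite -(tofrac_eq (R := {poly R})) rmorphM /= -det_zsub.
have := congr1 determinant MG; rewrite det_mulmx det1 dG => E.
by rewrite -[X in X == _]mul1r -E mulrA divfK ?tofrac_neq0.
Qed.

Lemma resolvent_proper a (M : 'M[R]_a) : proper_mx (invmx (zsub M)).
Proof.
move=> i j; have [p [E sp]] := resolvent_entry M i j.
by exists p, (char_poly M); rewrite monic_neq0 ?char_poly_monic ?(ltnW sp).
Qed.

End ConstantMatrices.

(** * State-space realizations *)

Section Realizations.
Variable R : realType.

(** Trades the inverse for a linear equation on the state response [X], so that composite
    realizations are checked by block multiplication. *)
Lemma realizesP k a b (A : 'M[R]_k) (B : 'M_(k, b)) (C : 'M_(a, k)) (D : 'M_(a, b)) K :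
  realizes A B C D K <-> exists X,
    zsub A *m X = constmx B /\ K = constmx C *m X + constmx D.
Proof.
split=> [->|[X [AX ->]]].
  exists (invmx (zsub A) *m constmx B).
  by rewrite mulKVmx ?zsub_unit // mulmxA.
by rewrite /realizes -AX -!mulmxA mulKmx ?zsub_unit.
Qed.

(* The feedthrough matrix is tracked because a realization can be inverted
   exactly when it is invertible. *)
Definition realizable a b (D : 'M[R]_(a, b)) (K : 'M[ratfun R]_(a, b)) : Prop :=
  exists (k : nat) (A : 'M_k) (B : 'M_(k, b)) (C : 'M_(a, k)), realizes A B C D K.

Lemma realizable_const a b (D : 'M[R]_(a, b)) : realizable D (constmx D).
Proof.
exists 0, 0, 0, 0; apply/realizesP; exists 0.
by rewrite !mulmx0 constmx0 add0r.
Qed.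

Lemma realizable_zinv a : realizable (0 : 'M[R]_a) ((zvar R)^-1%:M).
Proof.
exists a, 0, 1%:M, 1%:M; apply/realizesP; exists ((zvar R)^-1%:M).
rewrite constmx1 mul1mx constmx0 addr0 /zsub constmx0 subr0 -scalar_mxM.
by rewrite divff ?zvar_neq0.
Qed.

(** Parallel connection. *)
Lemma realizableD a b (D1 D2 : 'M[R]_(a, b)) K1 K2 :
  realizable D1 K1 -> realizable D2 K2 -> realizable (D1 + D2) (K1 + K2).
Proof.
move=> [k1 [A1 [B1 [C1 /realizesP[X1 [E1 ->]]]]]].
move=> [k2 [A2 [B2 [C2 /realizesP[X2 [E2 ->]]]]]].
exists (k1 + k2)%N, (block_mx A1 0 0 A2), (col_mx B1 B2), (row_mx C1 C2).
apply/realizesP; exists (col_mx X1 X2); split.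
  by rewrite zsub_block !constmx0 !oppr0 mul_block_col !mul0mx addr0 add0r
    E1 E2 constmx_col.
by rewrite constmx_row mul_row_col constmxD addrACA.
Qed.

(** Series connection: the output [G] of the second system drives the first, whose state response
    becomes [X1 *m G]. *)
Lemma realizableM a b c (D1 : 'M[R]_(a, b)) (D2 : 'M[R]_(b, c)) K1 K2 :
  realizable D1 K1 -> realizable D2 K2 -> realizable (D1 *m D2) (K1 *m K2).
Proof.
move=> [k1 [A1 [B1 [C1 /realizesP[X1 [E1 ->]]]]]].
move=> [k2 [A2 [B2 [C2 /realizesP[X2 [E2 ->]]]]]].
set G := _ + constmx D2.
exists (k1 + k2)%N, (block_mx A1 (B1 *m C2) 0 A2), (col_mx (B1 *m D2) B2),
  (row_mx C1 (D1 *m C2)).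
apply/realizesP; exists (col_mx (X1 *m G) X2); split.
  rewrite zsub_block mul_block_col constmx0 oppr0 mul0mx add0r E2 constmx_col.
  congr col_mx; rewrite mulmxA E1 !constmxM mulNmx -mulmxA -mulmxBr.
  by rewrite /G addrC addKr.
by rewrite constmx_row mul_row_col mulmxDl !constmxM -!mulmxA -addrA -mulmxDr.
Qed.

Lemma realizableN a b (D : 'M[R]_(a, b)) K : realizable D K -> realizable (- D) (- K).
Proof.
move=> H; have := realizableM (realizable_const (- 1%:M)) H.
by rewrite constmxN constmx1 !mulNmx !mul1mx.
Qed.

(** The inverse system solves the output equation for the input and substitutes it into the state
    equation; this gives the state matrix [A'], with state response [X'] and transfer matrix
    [K']. *)
Lemma realizableV a (D : 'M[R]_a) K :
  D \in unitmx -> realizable D K -> K \in unitmx /\ realizable (invmx D) (invmx K).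
Proof.
move=> uD [k [A [B [C /realizesP[X [E KE]]]]]].
have DD : constmx D *m constmx (invmx D) = 1%:M.
  by rewrite -constmxM mulmxV // constmx1.
pose A' := A - B *m invmx D *m C.
pose X' := invmx (zsub A') *m constmx (B *m invmx D).
pose K' := constmx (- invmx D *m C) *m X' + constmx (invmx D).
have E' : zsub A' *m X' = constmx (B *m invmx D).
  by rewrite mulKVmx ?zsub_unit.
have DK' : constmx D *m K' = 1%:M - constmx C *m X'.
  rewrite mulmxDr DD mulNmx constmxN mulNmx mulmxN constmxM -mulmxA mulmxA DD.
  by rewrite mul1mx addrC.
have AX' : zsub A *m X' = constmx B *m K'.
  have -> : zsub A = zsub A' - constmx (B *m invmx D *m C).
    by rewrite /zsub /A' constmxD constmxN opprD opprK addrA addrK.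
  rewrite mulmxBl E' /K' mulmxDr !constmxM constmxN !mulNmx mulmxN addrC.
  by rewrite !mulmxA.
(* [X'] is also the state response of the original system driven by [K']. *)
have XE : X' = X *m K'.
  by apply: (can_inj (mulKmx (zsub_unit A))); rewrite AX' mulmxA E.
have KK' : K *m K' = 1%:M.
  by rewrite KE mulmxDl DK' -mulmxA -XE addrC subrK.
have [uK _] := mulmx1_unit KK'; split=> //.
have -> : invmx K = K' by rewrite -[LHS]mulmx1 -KK' mulKmx.
by exists k, A', (B *m invmx D), (- invmx D *m C); apply/realizesP; exists X'.
Qed.

(** Horner's scheme with delays: writing [p] as [q * 'X] plus a constant [c], one has
    [p / z^(d+1) = q / z^d + z^-1 (c / z^d)]. *)
Lemma realizable_poly d (p : {poly R}) : (size p <= d.+1)%N ->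
  realizable (p`_d)%:M ((tofrac p / zvar R ^+ d)%:M : 'M_1).
Proof.
elim: d p => [|d IH] p sp.
  rewrite expr0 divr1 [p]size1_polyC // coefC eqxx.
  have := realizable_const ((p`_0)%:M : 'M[R]_1); congr realizable.
  by apply/matrixP => i j; rewrite !ord1 !mxE eqxx !mulr1n.
have pE := poly_take_drop 1 p.
have t0 : take_poly 1 p = (p`_0)%:P.
  by apply/polyP => -[|i]; rewrite coef_take_poly coefC.
rewrite expr1 t0 addrC in pE.
set q := drop_poly 1 p in pE.
have qd : q`_d = p`_d.+1 by rewrite coef_drop_poly addn1.
have sq : (size q <= d.+1)%N by rewrite size_drop_poly leq_subLR add1n.
have -> : (tofrac p / zvar R ^+ d.+1)%:M
    = (tofrac q / zvar R ^+ d)%:M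
      + (zvar R)^-1%:M *m (tofrac (p`_0)%:P / zvar R ^+ d)%:M :> 'M_1.
  rewrite -scalar_mxM -raddfD /=; congr (_%:M).
  rewrite -[in LHS]pE rmorphD rmorphM /= mulrDl exprS invfM -/(zvar R).
  congr (_ + _); last by rewrite mulrCA.
  by rewrite mulrA mulfK // zvar_neq0.
rewrite -[X in realizable X _]addr0 -qd; apply: realizableD; first exact: IH.
(* The delay has zero feedthrough, so this summand contributes nothing to the feedthrough. *)
rewrite -(mul0mx 1 ((p`_0)%:P`_d)%:M); apply: realizableM.
  exact: realizable_zinv.
by apply: IH; rewrite size_polyC; case: eqP.
Qed.

(** Divide numerator and denominator by [z^d], where [d] is the degree of [q]. The denominator then
    has the leading coefficient of [q] as feedthrough and is invertible as a system. *)
Lemma realizable_scalar (g : ratfun R) :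
  Defs.proper g -> exists c : R, realizable c%:M (g%:M : 'M_1).
Proof.
move=> [p [q [q0 -> spq]]].
have := realizable_poly (d := (size q).-1) (p := q).
have := realizable_poly (d := (size q).-1) (p := p).
rewrite prednK ?size_poly_gt0 // => /(_ spq) Hp /(_ (leqnn _)) Hq.
have lq : (q`_(size q).-1)%:M \in @unitmx R 1.
  by rewrite unitmxE det_scalar1 unitfE -lead_coefE lead_coef_eq0.
have [uq Hq'] := realizableV lq Hq.
exists (p`_(size q).-1 * (q`_(size q).-1)^-1).
have := realizableM Hp Hq'.
rewrite !invmx_scalar -!scalar_mxM; congr (realizable _ _%:M).
have cancel_div (F : fieldType) (x y w : F) : w != 0 -> x / w / (y / w) = x / y.
  by move=> w0; rewrite invf_div mulrA divfK.
apply: cancel_div.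
apply: expf_neq0.
exact: zvar_neq0.
Qed.

Lemma realizable_proper_mx a b (K : 'M[ratfun R]_(a, b)) :
  proper_mx K -> exists D, realizable D K.
Proof.
move=> pK.
rewrite [K]matrix_sum_delta.
pose P (K : 'M[ratfun R]_(a, b)) := exists D, realizable D K.
have P0 : P 0 by exists 0; rewrite -constmx0; apply: realizable_const.
have PD : forall F G, P F -> P G -> P (F + G).
  by move=> F G [D1 H1] [D2 H2]; exists (D1 + D2); apply: realizableD.
apply: (big_ind P) => // i _; apply: (big_ind P) => // j _.
have [c Hc] := realizable_scalar (pK i j).
exists ((delta_mx i 0 : 'cV_a) *m c%:M *m (delta_mx 0 j : 'rV_b)).
have -> : K i j *: delta_mx i j
    = constmx (delta_mx i 0 : 'cV_a) *m (K i j)%:M *m constmx (delta_mx 0 j : 'rV_b).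
  rewrite mul_mx_scalar -scalemxAl -constmxM mul_delta_mx.
  by congr (_ *: _); rewrite constmxE map_delta_mx.
apply: realizableM; last exact: realizable_const.
by apply: realizableM; first exact: realizable_const.
Qed.

Lemma realizable_proper a b (D : 'M[R]_(a, b)) K : realizable D K -> proper_mx K.
Proof.
move=> [k [A [B [C ->]]]]; apply: proper_mxD; last exact: proper_constmx.
apply: proper_mxM; last exact: proper_constmx.
by apply: proper_mxM; [exact: proper_constmx | exact: resolvent_proper].
Qed.

End Realizations.

(** * Stabilizing feedback *)

Section StateFeedback.
Variable R : realType.

(** The two products share their nonzero eigenvalues: a left eigenvector [v] of [W *m N] yields
    [v *m W]. The eigenvalue 0 is harmless. *)
Lemma schur_mulC a b (W : 'M[R]_(a, b)) (N : 'M[R]_(b, a)) :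
  schur (N *m W) -> schur (W *m N).
Proof.
move=> H s /eigenvalueP[v vE v0].
have [->|s0] := eqVneq s 0; first by rewrite normr0 ltr01.
apply: H; apply/eigenvalueP; rewrite !map_mxM in vE *.
exists (v *m map_mx (real_complex R) W).
  by rewrite scalemxAl -vE !mulmxA.
apply: contraNneq v0 => vW0; move: vE; rewrite mulmxA vW0 mul0mx => /esym/eqP.
by rewrite scaler_eq0 (negPf s0).
Qed.

Lemma schur_dim0 (A : 'M[R]_0) : schur A.
Proof. by move=> s /eigenvalueP[v _]; rewrite (thinmx0 v) eqxx. Qed.

(** The rows of [Q] form a basis of the left kernel of [B], and [V] is a right inverse of [Q]. The
    left kernel annihilates [1%:M - V *m Q], so the columns of this matrix lie in the range of
    [B]. *)
Lemma range_complement (F : fieldType) k m (B : 'M[F]_(k, m)) :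
  exists q (Q : 'M_(q, k)) (V : 'M_(k, q)) (X : 'M_(m, k)),
    [/\ q = (k - \rank B)%N, Q *m B = 0, Q *m V = 1%:M & 1%:M - V *m Q = B *m X].
Proof.
have [V QV] : exists V, row_base (kermx B) *m V = 1%:M.
  exact/row_freeP/row_base_free.
have QB : row_base (kermx B) *m B = 0.
  by apply/eqP; rewrite -sub_kermx eq_row_base.
suff /submxP[Z ZE] : ((1%:M - V *m row_base (kermx B))^T <= B^T)%MS.
  exists (\rank (kermx B)), (row_base (kermx B)), V, Z^T.
  by split; rewrite ?mxrank_ker // -[LHS]trmxK ZE trmx_mul trmxK.
have /submxP[Z ZE] : ((cokermx B^T)^T <= row_base (kermx B))%MS.
  rewrite eq_row_base; apply/sub_kermxP.
  by rewrite -[X in _ *m X]trmxK -trmx_mul mulmx_coker trmx0.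
rewrite submxE -[cokermx _]trmxK ZE -trmx_mul -mulmxA mulmxBr mulmx1.
by rewrite [_ *m (V *m _)]mulmxA QV mul1mx subrr mulmx0 trmx0.
Qed.

(* Induction on the state dimension: the dynamics induced on the quotient by
   the range of B, with input matrix Q A B, is a smaller system. *)
Lemma stabilizable_or_reducible k m (A : 'M[R]_k) (B : 'M[R]_(k, m)) :
  stabilizable A B \/
  exists (j : nat) (T : 'M[R]_(k, j)) (A' : 'M_j) (B' : 'M_(j, m)),
    [/\ (\rank T < k)%N, A *m T = T *m A' & B = T *m B'].
Proof.
elim/ltn_ind: k m A B => k IH m A B.
case: (posnP k) => [k0|kpos].
  by subst k; left; exists 0; apply: schur_dim0.
(* For [B = 0] the quotient would be no smaller, but the zero subspace ([T] without columns) is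
   invariant and contains the range of [B]. *)
have [B0|B0] := eqVneq B 0.
  right; exists 0, 0, 0, 0; split; rewrite ?mxrank0 ?mulmx0 ?mul0mx //.
have [q [Q [V [X [qE QB QV XE]]]]] := range_complement B.
have rB : (0 < \rank B <= k)%N by rewrite lt0n mxrank_eq0 B0 rank_leq_row.
have qk : (q < k)%N by rewrite qE; lia.
have QI x (M : 'M_(k, x)) : M = B *m (X *m M) + V *m (Q *m M).
  by rewrite !mulmxA -XE mulmxBl mul1mx subrK.
have [[G HG]|[j [T [A' [B' [rT AT BT]]]]]] := IH q qk m (Q *m A *m V) (Q *m A *m B).
  (* This feedback turns the state matrix into [W *m (Q *m A)]. Swapping the factors gives
     [Q *m A *m W], the quotient dynamics under the feedback [G]. *)
  left; exists (- (X - G *m Q) *m A).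
  pose W := V + B *m G.
  have -> : A + B *m (- (X - G *m Q) *m A) = W *m (Q *m A).
    rewrite {1}(QI _ A) /W mulmxDl mulNmx mulmxN mulmxBl mulmxBr opprB !mulmxA.
    by rewrite [X in X + _ = _]addrC -addrA [X in _ + X]addrC subrK.
  by apply: schur_mulC; rewrite mulmxDr mulmxA.
(* The invariant subspace of the quotient is lifted and the range of [B] added; the rank stays below
   [\rank B + q = k]. *)
right; exists (m + j)%N, (row_mx B (V *m T)),
  (block_mx (X *m A *m B) (X *m A *m V *m T) B' A'), (col_mx 1%:M 0); split.
- rewrite -mxrank_tr tr_row_mx -addsmxE.
  apply: leq_ltn_trans (mxrank_adds_leqif _ _) _; rewrite !mxrank_tr.
  by have := mxrankM_maxr V T; lia.
- rewrite mul_mx_row mul_row_block; congr row_mx.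
    by rewrite {1}(QI _ (A *m B)) [Q *m _]mulmxA BT !mulmxA.
  by rewrite {1}(QI _ (A *m (V *m T))) [Q *m _]mulmxA [_ *m (V *m T)]mulmxA AT !mulmxA.
- by rewrite mul_row_col mulmx1 mulmx0 addr0.
Qed.
End StateFeedback.

(** * Stabilizable and detectable realizations *)

Section StabilizableRealizations.
Variable R : realType.

Lemma realizes_tr k a b (A : 'M[R]_k) (B : 'M_(k, b)) (C : 'M_(a, k)) (D : 'M_(a, b)) K :
  realizes A B C D K -> realizes A^T C^T B^T D^T K^T.
Proof.
move=> ->; rewrite /realizes raddfD /= !trmx_mul trmx_inv -zsub_tr !constmx_tr.
by rewrite mulmxA.
Qed.

(** The range of [T] is invariant and contains the range of [B], so the state response never leaves
    it: it is [T] times the response of [A'], [B']. *)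
Lemma realizes_restrict k j a b (A : 'M[R]_k) (B : 'M_(k, b)) (C : 'M_(a, k))
    (D : 'M_(a, b)) K (T : 'M_(k, j)) (A' : 'M_j) (B' : 'M_(j, b)) :
  A *m T = T *m A' -> B = T *m B' ->
  realizes A B C D K -> realizes A' B' (C *m T) D K.
Proof.
move=> AT BT /realizesP[X [EX KE]]; apply/realizesP.
exists (invmx (zsub A') *m constmx B'); split; first by rewrite mulKVmx ?zsub_unit.
rewrite KE constmxM -mulmxA; congr (_ *m _ + _).
apply: (can_inj (mulKmx (zsub_unit A))); rewrite EX mulmxA.
have -> : zsub A *m constmx T = constmx T *m zsub A'.
  by rewrite mulmxBl mulmxBr -!constmxM AT mul_scalar_mx mul_mx_scalar.
by rewrite -mulmxA mulKVmx ?zsub_unit // -constmxM BT.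
Qed.

(** [T] may have dependent columns. Its rank factorization [U *m W] supplies independent ones, so
    the new state dimension is exactly [\rank T]. *)
Lemma realizes_shrink k j a b (A : 'M[R]_k) (B : 'M_(k, b)) (C : 'M_(a, k))
    (D : 'M_(a, b)) K (T : 'M_(k, j)) (A' : 'M_j) (B' : 'M_(j, b)) :
  A *m T = T *m A' -> B = T *m B' -> realizes A B C D K ->
  exists (A1 : 'M_(\rank T)) B1 C1, realizes A1 B1 C1 D K.
Proof.
move=> AT BT HK.
have [S RS] : exists S, row_base T *m S = 1%:M by exact/row_freeP/row_base_free.
move: S (mulmx_base T) RS; move: (\rank T) (col_base T) (row_base T) => r U W S TE WS.
exists (W *m A' *m S), (W *m B'), (C *m U).
apply: realizes_restrict HK; last by rewrite mulmxA TE.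
by rewrite !mulmxA TE -AT -TE -!mulmxA WS mulmx1.
Qed.

(** Strong induction on the state dimension. A failure of stabilizability allows shrinking;
    detectability is treated as stabilizability of the transposed system. *)
Lemma minimal_realization a b (D : 'M[R]_(a, b)) K : realizable D K ->
  exists (k : nat) (A : 'M_k) (B : 'M_(k, b)) (C : 'M_(a, k)),
    controller_realization A B C D K.
Proof.
move=> [k]; elim/ltn_ind: k => k IH [A [B [C HK]]].
have [sB|[j [T [A' [B' [rT AT BT]]]]]] := stabilizable_or_reducible A B; last first.
  by apply: IH rT _; apply: realizes_shrink HK; eassumption.
have [[F sC]|[j [T [A' [B' [rT AT BT]]]]]] := stabilizable_or_reducible A^T C^T.
  exists k, A, B, C; split=> //; exists F^T.
  by have := schur_tr sC; rewrite linearD /= trmx_mul !trmxK.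
apply: IH rT _.
have [A1 [B1 [C1 H1]]] := realizes_shrink AT BT (realizes_tr HK).
exists A1^T, C1^T, B1^T.
by have := realizes_tr H1; rewrite !trmxK.
Qed.

End StabilizableRealizations.

(** * Closed loop *)

Section ClosedLoop.
Variable R : realType.

Lemma realizes_output k a b e (A : 'M[R]_k) (B : 'M_(k, b)) (C : 'M_(a, k))
    (D : 'M_(a, b)) K (xi : 'M_(k, e)) (y : 'M_(b, e)) :
  realizes A B C D K -> zsub A *m xi = constmx B *m y ->
  constmx C *m xi + constmx D *m y = K *m y.
Proof.
move=> -> E; rewrite mulmxDl -!mulmxA -E mulKmx //.
exact: zsub_unit.
Qed.

Lemma eliminate_controller (F : pzRingType) n m p k e (P : 'M[F]_n) (B : 'M_(n, m))
    (C : 'M_(p, n)) (Ck : 'M_(m, k)) (D K : 'M_(m, p)) (w x : 'M_(n, e))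
    (xi : 'M_(k, e)) (v : 'M_(p, e)) :
  (P - B *m D *m C) *m x + - (B *m Ck) *m xi = w + B *m D *m v ->
  K *m (C *m x + v) = Ck *m xi + D *m (C *m x + v) ->
  (P - B *m K *m C) *m x = w + B *m K *m v.
Proof.
move=> E1 /(congr1 (mulmx B)).
move: E1; rewrite !(mulmxBl, mulmxDr, mulNmx, mulmxA) => /eqP.
rewrite !subr_eq => /eqP E1 E3; apply: (addIr (B *m K *m C *m x)).
rewrite subrK -addrA [X in w + X]addrC E3 E1 -!addrA.
by rewrite [X in w + X = _]addrC -addrA.
Qed.

Lemma zsub_closed_loop n m p k (A : 'M[R]_n) (B2 : 'M_(n, m)) (C2 : 'M_(p, n))
    (Ak : 'M_k) (Bk : 'M_(k, p)) (Ck : 'M_(m, k)) (Dk : 'M_(m, p)) :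
  zsub (closed_loop_mx A B2 C2 Ak Bk Ck Dk) =
  block_mx (zsub A - constmx B2 *m constmx Dk *m constmx C2) (- (constmx B2 *m constmx Ck))
    (- (constmx Bk *m constmx C2)) (zsub Ak).
Proof.
rewrite zsub_block -!constmxM; congr block_mx.
by rewrite /zsub constmxD opprD addrA.
Qed.

(** Here [w] and [v] stand for the disturbances on the state and on the measurement, one experiment
    per column. *)
Lemma closed_loop_signals n m p k e (A : 'M[R]_n) (B2 : 'M_(n, m)) (C2 : 'M_(p, n))
    (Ak : 'M_k) (Bk : 'M_(k, p)) (Ck : 'M_(m, k)) (Dk : 'M_(m, p)) K
    (w : 'M_(n, e)) (v : 'M_(p, e)) x xi :
  realizes Ak Bk Ck Dk K ->
  zsub (closed_loop_mx A B2 C2 Ak Bk Ck Dk) *m col_mx x xi =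
    col_mx (w + constmx B2 *m constmx Dk *m v) (constmx Bk *m v) ->
  (zsub A - constmx B2 *m K *m constmx C2) *m x = w + constmx B2 *m K *m v
  /\ K *m (constmx C2 *m x + v)
     = constmx Ck *m xi + constmx Dk *m (constmx C2 *m x + v).
Proof.
move=> HK; rewrite zsub_closed_loop mul_block_col => /eq_col_mx[E1 E2].
have Ey : zsub Ak *m xi = constmx Bk *m (constmx C2 *m x + v).
  by rewrite mulmxDr -E2 mulNmx mulmxA addNKr.
have KE := realizes_output HK Ey; split; last by rewrite KE.
exact: eliminate_controller E1 (esym KE).
Qed.

Lemma stabilized_response n m p k (A : 'M[R]_n) (B2 : 'M_(n, m)) (C2 : 'M_(p, n))
    (Ak : 'M_k) (Bk : 'M_(k, p)) (Ck : 'M_(m, k)) (Dk : 'M_(m, p)) K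
    Pxx Pux Pxy Puy :
  realizes Ak Bk Ck Dk K -> schur (closed_loop_mx A B2 C2 Ak Bk Ck Dk) ->
  achieves A B2 C2 K Pxx Pux Pxy Puy ->
  [/\ zRHinf_mx Pxx, zRHinf_mx Pux & zRHinf_mx Pxy] /\ RHinf_mx Puy.
Proof.
set M := closed_loop_mx _ _ _ _ _ _ _.
move=> HK /schur_resolvent sM [[uL ->] -> -> ->].
set L := _ - _ in uL *.
have response e (w : 'M[ratfun R]_(n, e)) (v : 'M_(p, e)) :
    RHinf_mx w -> RHinf_mx v -> exists x xi,
      [/\ zRHinf_mx x, zRHinf_mx xi, L *m x = w + constmx B2 *m K *m v
        & K *m (constmx C2 *m x + v)
          = constmx Ck *m xi + constmx Dk *m (constmx C2 *m x + v)].
  move=> Hw Hv.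
  pose W := invmx (zsub M) *m col_mx (w + constmx B2 *m constmx Dk *m v) (constmx Bk *m v).
  have HW : zRHinf_mx W.
    apply: zRHinf_mxM => //; apply: RHinf_col_mx; last first.
      by apply: RHinf_mxM => //; apply: RHinf_constmx.
    apply: RHinf_mxD => //; apply: RHinf_mxM => //.
    by apply: RHinf_mxM; apply: RHinf_constmx.
  exists (usubmx W), (dsubmx W).
  have EW : zsub M *m col_mx (usubmx W) (dsubmx W)
      = col_mx (w + constmx B2 *m constmx Dk *m v) (constmx Bk *m v).
    by rewrite vsubmxK mulKVmx ?zsub_unit.
  have [E1 E2] := closed_loop_signals HK EW.
  by split=> //; rewrite /zRHinf_mx -linearZ => i j; rewrite mxE; apply: HW.
(* An impulse on the state produces [Pxx] as plant state, and an impulse on the measurement produces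
   [Pxy]; the controller outputs are then [Pux] and [Puy]. *)
have [X1 [Y1 [sX1 sY1 E1 U1]]] := response _ 1%:M (constmx 0)
  (RHinf_scalar_mx (RHinf1 R)) (RHinf_constmx 0).
have [X2 [Y2 [sX2 sY2 E2 U2]]] := response _ (constmx 0) 1%:M
  (RHinf_constmx 0) (RHinf_scalar_mx (RHinf1 R)).
move: E1 U1 E2 U2; rewrite !constmx0 mulmx1 mulmx0 !addr0 add0r => E1 U1 E2 U2.
have -> : invmx L = X1 by rewrite -[LHS]mulmx1 -E1 mulKmx.
have X2E : X2 = X1 *m constmx B2 *m K.
  apply: (can_inj (mulKmx uL)); rewrite E2 !mulmxA E1.
  by rewrite mul1mx.
rewrite -X2E; split.
  split=> //; rewrite -mulmxA U1.
  rewrite /zRHinf_mx scalerDr; apply: RHinf_mxD; apply: zRHinf_mxMr => //.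
  - exact: RHinf_constmx.
  - exact: RHinf_constmx.
  - by apply: zRHinf_mxMr => //; apply: RHinf_constmx.
have -> : K + K *m constmx C2 *m X1 *m constmx B2 *m K = K *m (constmx C2 *m X2 + 1%:M).
  by rewrite mulmxDr mulmx1 addrC X2E !mulmxA.
rewrite U2; apply: RHinf_mxD; apply: RHinf_mxM; try exact: RHinf_constmx.
  exact: zRHinf_mxW.
apply: RHinf_mxD; last exact: RHinf_scalar_mx (RHinf1 R).
by apply: RHinf_mxM; [exact: RHinf_constmx | exact: zRHinf_mxW].
Qed.

End ClosedLoop.

(** * System responses and the controller recovered from them *)

Section SystemResponse.
Variables (R : realType) (n m p : nat).
Variables (A : 'M[R]_n) (B2 : 'M[R]_(n, m)) (C2 : 'M[R]_(p, n)).
Variables (Pxx : 'M[ratfun R]_n) (Pux : 'M[ratfun R]_(m, n)).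
Variables (Pxy : 'M[ratfun R]_(n, p)) (Puy : 'M[ratfun R]_(m, p)).

Definition response_equations : Prop :=
  [/\ zsub A *m Pxx = 1%:M + constmx B2 *m Pux,
      zsub A *m Pxy = constmx B2 *m Puy,
      Pxx *m zsub A = 1%:M + Pxy *m constmx C2
    & Pux *m zsub A = Puy *m constmx C2].

Lemma in_affine_subspaceE :
  in_affine_subspace A B2 C2 Pxx Pux Pxy Puy <->
  [/\ response_equations,
      [/\ zRHinf_mx Pxx, zRHinf_mx Pux & zRHinf_mx Pxy] & RHinf_mx Puy].
Proof.
rewrite /in_affine_subspace mul_row_block mul_block_col !mulNmx !mulmxN.
split=> [[/eq_row_mx[E1 E2] /eq_col_mx[E3 E4] st su]|[[E1 E2 E3 E4] st su]].
  split=> //; split.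
  - by rewrite -E1 subrK.
  - by apply/eqP; rewrite -subr_eq0 E2.
  - by rewrite -E3 subrK.
  - by apply/eqP; rewrite -subr_eq0 E4.
by rewrite E1 E2 E3 E4 !addrK !subrr.
Qed.

Lemma achieves_response_equations K :
  achieves A B2 C2 K Pxx Pux Pxy Puy -> response_equations.
Proof.
rewrite /response_equations => -[[uL Pxx_def] -> -> ->]; set L := _ - _ in uL Pxx_def.
have aE : zsub A = L + constmx B2 *m K *m constmx C2 by rewrite subrK.
have LP : L *m Pxx = 1%:M by rewrite Pxx_def mulmxV.
have PL : Pxx *m L = 1%:M by rewrite Pxx_def mulVmx.
move: (zsub A) (constmx B2) (constmx C2) L {uL Pxx_def} aE LP PL => a b c L -> LP PL.
split.
- by rewrite mulmxDl LP !mulmxA.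
- by rewrite !mulmxA mulmxDl LP !mulmxDr !mulmxDl mul1mx !mulmxA.
- by rewrite mulmxDr PL !mulmxA.
- by rewrite -!mulmxA mulmxDr PL !mulmxDl !mulmxDr mulmx1 !mulmxA.
Qed.

Definition response_controller : 'M[ratfun R]_(m, p) :=
  Puy - Pux *m invmx Pxx *m Pxy.

(** Substituting [Puy C2] and [Pxy C2] from the right-hand identities collapses [K C2] to
    [Pux Pxx^-1]. The first identity then turns [zI - A - B2 K C2] into [Pxx^-1]. *)
Lemma response_equations_achieves : response_equations -> Pxx \in unitmx ->
  [/\ achieves A B2 C2 response_controller Pxx Pux Pxy Puy,
      constmx B2 *m response_controller = invmx Pxx *m Pxy
    & response_controller *m constmx C2 = Pux *m invmx Pxx].
Proof.
rewrite /response_equations /achieves /response_controller.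
move: (zsub A) (constmx B2) (constmx C2) => a b c [E1 E2 E3 E4] uP.
set K := Puy - _.
have KC : K *m c = Pux *m invmx Pxx.
  rewrite mulmxBl -E4 -(mulmxA _ Pxy).
  have -> : Pxy *m c = Pxx *m a - 1%:M by rewrite E3 addrC addKr.
  by rewrite mulmxBr mulmxA mulmxKV // mulmx1 opprB addrC subrK.
have BK : b *m K = invmx Pxx *m Pxy.
  rewrite mulmxBr -E2 !mulmxA.
  have -> : b *m Pux = a *m Pxx - 1%:M by rewrite E1 addrC addKr.
  by rewrite mulmxBl mulmxK // mul1mx mulmxBl opprB addrC subrK.
have LE : a - b *m K *m c = invmx Pxx.
  rewrite -mulmxA KC mulmxA.
  have -> : b *m Pux = a *m Pxx - 1%:M by rewrite E1 addrC addKr.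
  by rewrite mulmxBl mulmxK // mul1mx opprB addrC subrK.
split; [rewrite LE invmxK unitmx_inv | exact: BK | exact: KC].
split; [by split | by rewrite KC mulmxKV | by rewrite -mulmxA BK mulKVmx |].
by rewrite KC mulmxKV // -mulmxA BK mulmxA /K subrK.
Qed.

Hypothesis affine : in_affine_subspace A B2 C2 Pxx Pux Pxy Puy.

(** [F] is a unit delay applied to the proper matrix [z F], and the delay has zero feedthrough. *)
Lemma zRHinf_realizable a b (F : 'M[ratfun R]_(a, b)) :
  zRHinf_mx F -> realizable 0 F.
Proof.
move=> HF; have [D HD] : exists D, realizable D (zvar R *: F).
  by apply: realizable_proper_mx => i j; case: (HF i j).
have := realizableM (realizable_zinv R a) HD.
rewrite mul0mx mul_scalar_mx scalerA mulVf ?scale1r //.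
exact: zvar_neq0.
Qed.

Lemma zPxx_realizable : realizable 1%:M (zvar R *: Pxx).
Proof.
have [[E1 _ _ _] [sxx sux _] _] := (in_affine_subspaceE.1 affine).
have -> : zvar R *: Pxx = constmx 1%:M + (constmx A *m Pxx + constmx B2 *m Pux).
  by rewrite constmx1 addrCA -E1 /zsub mulmxBl mul_scalar_mx addrC subrK.
rewrite -[X in realizable X]addr0; apply: realizableD; first exact: realizable_const.
rewrite -[X in realizable X]addr0; apply: realizableD.
  rewrite -(mulmx0 _ A); apply: realizableM; first exact: realizable_const.
  exact: zRHinf_realizable.
rewrite -(mulmx0 _ B2); apply: realizableM; first exact: realizable_const.
exact: zRHinf_realizable.
Qed.

Lemma Pxx_unit : Pxx \in unitmx.
Proof.
have [u _] := realizableV (unitmx1 R n) zPxx_realizable.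
rewrite unitmxZ // in u. 
by rewrite unitfE; exact: zvar_neq0.
Qed.

(** [Pxx] is strictly proper, so its inverse alone is not realizable in general; grouping the
    product as [Pux (z Pxx)^-1 (z Pxy)] makes every factor realizable. *)
Lemma response_controller_realizable : exists D, realizable D response_controller.
Proof.
have [[E1 _ _ _] [sxx sux sxy] suy] := (in_affine_subspaceE.1 affine).
have [_ rV] := realizableV (unitmx1 R n) zPxx_realizable.
have [D1 H1] : exists D, realizable D Puy.
  by apply: realizable_proper_mx => i j; case: (suy i j).
have [D2 H2] : exists D, realizable D (zvar R *: Pxy).
  by apply: realizable_proper_mx => i j; case: (sxy i j).
have HX := realizableM (zRHinf_realizable sux) rV.
have := realizableD H1 (realizableN (realizableM HX H2)).
set K := (X in realizable _ X); suff -> : response_controller = K.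
  by move=> HK; eexists; apply: HK.
have [uz _] := realizableV (unitmx1 R n) zPxx_realizable.
rewrite /K (invmxZ uz) -scalemxAr -scalemxAr -scalemxAl scalerA.
rewrite divff; last exact: zvar_neq0.
by rewrite scale1r.
Qed.

End SystemResponse.

(** * Closed-loop stability from stable responses *)

Section Stabilization.
Variable R : realType.

Lemma RHinf_constmxM a b c (M : 'M[R]_(a, b)) (F : 'M[ratfun R]_(b, c)) :
  RHinf_mx F -> RHinf_mx (constmx M *m F).
Proof. by apply: RHinf_mxM; apply: RHinf_constmx. Qed.

Lemma zsubD k (A M : 'M[R]_k) : zsub (A + M) = zsub A - constmx M.
Proof. by rewrite /zsub constmxD opprD addrA. Qed.

(* A static output injection L turns the state equation into a stable filter
   driven by the input and output of the controller. *)
Lemma detectable_state k a b e (A : 'M[R]_k) (B : 'M_(k, b)) (C : 'M_(a, k))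
    (D : 'M_(a, b)) (xi w : 'M[ratfun R]_(k, e)) y u :
  detectable A C ->
  zsub A *m xi = w + constmx B *m y -> constmx C *m xi + constmx D *m y = u ->
  RHinf_mx w -> RHinf_mx y -> RHinf_mx u -> RHinf_mx xi.
Proof.
move=> [L sL] E1 E2 sw sy su.
have E : zsub (A + L *m C) *m xi =
    w + constmx B *m y - constmx L *m (u - constmx D *m y).
  by rewrite zsubD mulmxBl constmxM -mulmxA E1 -E2 addrK.
rewrite -[xi](mulKmx (zsub_unit (A + L *m C))) E.
apply: RHinf_mxM; first exact/zRHinf_mxW/schur_resolvent.
apply: RHinf_mxB; first by apply: RHinf_mxD => //; apply: RHinf_constmxM.
by apply: RHinf_constmxM; apply: RHinf_mxB => //; apply: RHinf_constmxM.
Qed.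

Lemma closed_loop_mulmx n m p k e (A : 'M[R]_n) (B2 : 'M_(n, m)) (C2 : 'M_(p, n))
    (Ak : 'M_k) (Bk : 'M_(k, p)) (Ck : 'M_(m, k)) (Dk : 'M_(m, p))
    (x : 'M_(n, e)) xi u w w' :
  zsub A *m x = w + constmx B2 *m u ->
  zsub Ak *m xi = w' + constmx Bk *m (constmx C2 *m x) ->
  constmx Ck *m xi + constmx Dk *m (constmx C2 *m x) = u ->
  zsub (closed_loop_mx A B2 C2 Ak Bk Ck Dk) *m col_mx x xi = col_mx w w'.
Proof.
move=> E1 E2 E3; rewrite zsub_closed_loop mul_block_col; congr col_mx.
  by rewrite mulmxBl E1 -E3 mulNmx mulmxDr -!mulmxA addrA !addrK.
by rewrite E2 mulNmx -mulmxA addrC addrK.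
Qed.

(** The closed-loop resolvent is assembled from two block columns, the responses to impulses on the
    plant state and on the controller state. Detectability makes the controller state stable in
    both. *)
Lemma response_stabilizes n m p k (A : 'M[R]_n) (B2 : 'M_(n, m)) (C2 : 'M_(p, n))
    (Ak : 'M_k) (Bk : 'M_(k, p)) (Ck : 'M_(m, k)) (Dk : 'M_(m, p)) K
    Pxx Pux Pxy Puy :
  controller_realization Ak Bk Ck Dk K ->
  achieves A B2 C2 K Pxx Pux Pxy Puy ->
  RHinf_mx Pxx -> RHinf_mx Pux -> RHinf_mx Pxy -> RHinf_mx Puy ->
  schur (closed_loop_mx A B2 C2 Ak Bk Ck Dk).
Proof.
move=> [HK [F sF] dK] ach sxx sux sxy suy.
have [E1 E2 _ _] := achieves_response_equations ach.
have uxE : K *m (constmx C2 *m Pxx) = Pux by case: ach => _ -> _ _; rewrite mulmxA.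
have uyE : K + K *m (constmx C2 *m Pxy) = Puy.
  by case: ach => _ _ -> ->; rewrite !mulmxA.
have state e (y : 'M[ratfun R]_(p, e)) : exists2 xi, zsub Ak *m xi = constmx Bk *m y
    & constmx Ck *m xi + constmx Dk *m y = K *m y.
  pose xi := invmx (zsub Ak) *m (constmx Bk *m y).
  have E : zsub Ak *m xi = constmx Bk *m y by rewrite mulKVmx ?zsub_unit.
  by exists xi => //; apply: realizes_output E.
have [xi1 X1] := state _ (constmx C2 *m Pxx); rewrite uxE => U1.
have sxi1 : RHinf_mx xi1.
  apply: (detectable_state (B := Bk) (w := 0) dK _ U1) => //.
  - by rewrite add0r.
  - by move=> i j; rewrite mxE; apply: RHinf0.
  - exact: RHinf_constmxM.
(* A static state feedback F realizes an impulse on the controller state as a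
   stable signal eta, up to a measurement perturbation v and an input
   perturbation h, to which the loop responds through the given maps. *)
pose eta := invmx (zsub (Ak + Bk *m F)).
have seta : RHinf_mx eta by apply/zRHinf_mxW/schur_resolvent.
have Eeta : zsub Ak *m eta = 1%:M + constmx Bk *m (constmx F *m eta).
  apply/eqP; rewrite -subr_eq mulmxA -mulmxBl -constmxM -zsubD mulmxV //.
  exact: zsub_unit.
pose v := - (constmx F *m eta).
have sv : RHinf_mx v by apply/RHinf_mxN/RHinf_constmxM.
have [h hE] : exists h, h = constmx Ck *m eta - constmx Dk *m v by eexists.
have sh : RHinf_mx h by rewrite hE; apply: RHinf_mxB; apply: RHinf_constmxM.
(* An input perturbation [h] acts on the plant as the state disturbance [B2 h]; [x2] and [u2] are
   the resulting plant state and input. *)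
have [x2 x2E] : exists x2, x2 = Pxy *m v + Pxx *m (constmx B2 *m h) by eexists.
have sx2 : RHinf_mx x2.
  by rewrite x2E; apply: RHinf_mxD; apply: RHinf_mxM => //; apply: RHinf_constmxM.
pose u2 := Puy *m v + (Pux *m (constmx B2 *m h) + h).
have su2 : RHinf_mx u2.
  apply: RHinf_mxD; first exact: RHinf_mxM.
  by apply: RHinf_mxD => //; apply: RHinf_mxM => //; apply: RHinf_constmxM.
have Eu2 : K *m (constmx C2 *m x2 + v) + h = u2.
  rewrite x2E /u2 -uyE -uxE !(mulmxDr, mulmxDl, mulmxA).
  by rewrite [in RHS]addrA [X in X + h = _]addrC [X in X + h = _]addrA.
(* Adding [eta], which is driven by the impulse and by [- v], cancels the fictitious [v] at the
   controller input; [h] compensates for it at the output. *)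
have [zeta Z1 Z2] := state _ (constmx C2 *m x2 + v).
have X2 : zsub Ak *m (eta + zeta) = 1%:M + constmx Bk *m (constmx C2 *m x2).
  by rewrite mulmxDr Eeta Z1 mulmxDr mulmxN addrACA subrr addr0.
have U2 : constmx Ck *m (eta + zeta) + constmx Dk *m (constmx C2 *m x2) = u2.
  rewrite -Eu2 -Z2 hE !mulmxDr [in RHS](addrA (constmx Ck *m zeta)).
  rewrite [in RHS]addrACA subrr addr0.
  by rewrite -[LHS]addrA [LHS]addrC.
have sxi2 : RHinf_mx (eta + zeta).
  apply: (detectable_state dK X2 U2) => //; last exact: RHinf_constmxM.
  exact: RHinf_scalar_mx (RHinf1 R).
have E3 : zsub A *m x2 = 0 + constmx B2 *m u2.
  rewrite add0r x2E mulmxDr mulmxA E2 mulmxA E1 mulmxDl mul1mx.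
  by rewrite /u2 !mulmxDr !mulmxA [X in _ + X]addrC.
apply: (resolvent_schur (G := row_mx (col_mx Pxx xi1) (col_mx x2 (eta + zeta)))).
  rewrite mul_mx_row (closed_loop_mulmx E3 X2 U2).
  rewrite (closed_loop_mulmx (w' := 0) E1 _ U1); last by rewrite add0r.
  by rewrite -block_mxEh scalar_mx_block.
by apply: RHinf_row_mx; apply: RHinf_col_mx.
Qed.
End Stabilization.

(** * Implementation of the controller *)

Section Implementation.

(** Multiplying the third relation by [a] and inserting the fourth forces [B = - (b *m u)]. The
    identities for [Pxx *m a] and [Pux *m a], applied to the plant state, then yield [x] and [u]. *)
Lemma solve_implementation (F : pzRingType) n m p e
    (a Pxx : 'M[F]_n) (b : 'M_(n, m)) (c : 'M_(p, n)) (Pux : 'M_(m, n))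
    (Pxy : 'M_(n, p)) (Puy : 'M_(m, p)) (x w B : 'M_(n, e)) (u : 'M_(m, e))
    (y v : 'M_(p, e)) :
  a *m Pxx = 1%:M + b *m Pux -> a *m Pxy = b *m Puy ->
  Pxx *m a = 1%:M + Pxy *m c -> Pux *m a = Puy *m c ->
  [/\ a *m x = w + b *m u, y = c *m x + v, Pxx *m B = - (Pxy *m y)
    & u = Pux *m B + Puy *m y] <->
  [/\ x = Pxx *m w + Pxy *m v, u = Pux *m w + Puy *m v, y = c *m x + v
    & B = - (b *m u)].
Proof.
move=> E1 E2 E3 E4.
have xP : a *m x = w + b *m u ->
    Pxx *m (b *m u) = x + Pxy *m (c *m x) - Pxx *m w.
  move=> Ex; have -> : b *m u = a *m x - w by rewrite Ex addrC addKr.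
  by rewrite mulmxBr mulmxA E3 mulmxDl mul1mx !mulmxA.
have uP : a *m x = w + b *m u -> Pux *m (b *m u) = Puy *m (c *m x) - Pux *m w.
  move=> Ex; have -> : b *m u = a *m x - w by rewrite Ex addrC addKr.
  by rewrite mulmxBr mulmxA E4 !mulmxA.
split=> [[Ex Ey EB Eu]|[Ex Eu Ey EB]].
  have BE : B = - (b *m u).
    apply/eqP; rewrite -addr_eq0 Eu mulmxDr addrA !mulmxA -E2.
    have -> : B + b *m Pux *m B = a *m (Pxx *m B) by rewrite mulmxA E1 mulmxDl mul1mx.
    by rewrite EB mulmxN mulmxA addNr.
  split=> //.
    move: EB; rewrite BE mulmxN xP // Ey => /oppr_inj /eqP.
    by rewrite subr_eq mulmxDr addrC -addrA (inj_eq (addrI _)) addrC => /eqP.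
  by rewrite [LHS]Eu BE mulmxN uP // Ey mulmxDr opprB -addrA addKr.
have Ea : a *m x = w + b *m u.
  by rewrite Ex Eu !mulmxDr !mulmxA E1 E2 mulmxDl mul1mx addrA.
split=> //.
  by rewrite EB mulmxN xP // Ey mulmxDr {1}Ex addrAC [X in X - _]addrC addrK addrC.
by rewrite EB mulmxN uP // Ey mulmxDr opprB -addrA addKr.
Qed.

Variable R : realType.

(* With z b = a (db / z) + B the perturbations merge into w = dx + b2 du and
   v = dy + c2 (db / z). *)
Lemma implementation_eqsE n m p (A : 'M[R]_n) (B2 : 'M_(n, m)) (C2 : 'M_(p, n))
    (Pxx : 'M_n) (Pux : 'M_(m, n)) (Pxy : 'M_(n, p)) (Puy : 'M_(m, p))
    (dx : 'cV_n) (dy : 'cV_p) (du : 'cV_m) (db : 'cV_n)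
    (x : 'cV_n) (u : 'cV_m) (y : 'cV_p) (b : 'cV_n) :
  let z := zvar R in
  let db' := z^-1 *: db in
  implementation_eqs A B2 C2 (z *: (1%:M - z *: Pxx)) (z *: Pux) (- (z *: Pxy)) Puy
    dx dy du db x u y b <->
  [/\ zsub A *m x = (dx + constmx B2 *m du) + constmx B2 *m (u - du),
      y + constmx C2 *m db' = constmx C2 *m x + (dy + constmx C2 *m db'),
      Pxx *m (z *: b) = db' - Pxy *m y
    & u - du = Pux *m (z *: b) + Puy *m y].
Proof.
move=> z db'; have z0 : z != 0 := zvar_neq0 R.
have zK k (v : 'cV_k) : z *: (z^-1 *: v) = v by rewrite scalerA divff // scale1r.
have e1 : zvar R *: x = constmx A *m x + constmx B2 *m u + dx <->
    zsub A *m x = (dx + constmx B2 *m du) + constmx B2 *m (u - du).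
  have -> : dx + constmx B2 *m du + constmx B2 *m (u - du) = dx + constmx B2 *m u.
    by rewrite -addrA -mulmxDr [du + _]addrC subrK.
  rewrite /zsub mulmxBl mul_scalar_mx -addrA [constmx A *m x + _]addrC.
  rewrite [constmx B2 *m u + _]addrC.
  by split=> [->|/eqP]; [rewrite addrK|rewrite subr_eq => /eqP].
have e2 : y = constmx C2 *m x + dy <->
    y + constmx C2 *m db' = constmx C2 *m x + (dy + constmx C2 *m db').
  by rewrite addrA; split=> [->|/addIr].
have e3 : z *: b = z *: (1%:M - z *: Pxx) *m b + - (z *: Pxy) *m y + db <->
    Pxx *m (z *: b) = db' - Pxy *m y.
  (* The right-hand side is [z b] plus [z] times the residual of the target equation, and [z] is
     nonzero. *)
  have -> : z *: (1%:M - z *: Pxx) *m b + - (z *: Pxy) *m y + db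
      = z *: b + z *: (db' - Pxy *m y - Pxx *m (z *: b)).
    rewrite -scalemxAl mulmxBl mul1mx -!scalemxAl mulNmx -scalemxAl.
    rewrite !scalerBr zK -scalemxAr -!addrA; congr (_ + _).
    by rewrite [LHS]addrA [LHS]addrC; congr (_ + _); apply: addrC.
  split=> [/eqP|->]; last by rewrite subrr scaler0 addr0.
  by rewrite -[X in X == _]addr0 (inj_eq (addrI _)) eq_sym scaler_eq0
    (negPf z0) subr_eq0 => /eqP ->.
have e4 : u = z *: Pux *m b + Puy *m y + du <-> u - du = Pux *m (z *: b) + Puy *m y.
  rewrite -scalemxAl -scalemxAr.
  by split=> [->|/eqP]; [rewrite addrK|rewrite subr_eq => /eqP].
split=> [[/e1 ? /e2 ? /e3 ? /e4 ?]|[/e1 ? /e2 ? /e3 ? /e4 ?]]; split; assumption.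
Qed.

Lemma implementation_stable n m p (A : 'M[R]_n) (B2 : 'M_(n, m)) (C2 : 'M_(p, n))
    (Pxx : 'M_n) (Pux : 'M_(m, n)) (Pxy : 'M_(n, p)) (Puy : 'M_(m, p)) :
  in_affine_subspace A B2 C2 Pxx Pux Pxy Puy ->
  implementation_internally_stable A B2 C2
    (zvar R *: (1%:M - zvar R *: Pxx)) (zvar R *: Pux) (- (zvar R *: Pxy)) Puy.
Proof.
move=> /in_affine_subspaceE[[E1 E2 E3 E4] [sxx sux sxy] suy].
have z0 := zvar_neq0 R.
pose zi := (zvar R)^-1.
(* These four matrices select the individual perturbations from the stacked vector. *)
pose Ex := constmx (row_mx 1%:M 0 : 'M[R]_(n, n + (p + (m + n)))).
pose Ey := constmx (row_mx 0 (row_mx 1%:M 0) : 'M[R]_(p, n + (p + (m + n)))).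
pose Eu := constmx (row_mx 0 (row_mx 0 (row_mx 1%:M 0)) : 'M[R]_(m, n + (p + (m + n)))).
pose Eb := constmx (row_mx 0 (row_mx 0 (row_mx 0 1%:M)) : 'M[R]_(n, n + (p + (m + n)))).
pose W := Ex + constmx B2 *m Eu.
pose V := Ey + constmx C2 *m (zi *: Eb).
pose Hx := Pxx *m W + Pxy *m V.
pose Hu := Pux *m W + Puy *m V + Eu.
pose Hy := constmx C2 *m Hx + Ey.
(* Solves [z b - (zI - A) (db / z) = - B2 (u - du)], the relation [B = - (b *m u)] of
   [solve_implementation], for [b]. *)
pose Hb := zi *: (zsub A *m (zi *: Eb) - constmx B2 *m (Hu - Eu)).
exists (col_mx Hx (col_mx Hu (col_mx Hy Hb))); split.
  move=> dx dy du db x u y b; rewrite implementation_eqsE.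
  set d := col_mx dx _; set db' := _ *: db.
  have [Exd Eyd Eud Ebd] : [/\ Ex *m d = dx, Ey *m d = dy, Eu *m d = du & Eb *m d = db].
    split; rewrite /Ex /Ey /Eu /Eb !constmx_row ?constmx1 ?constmx0;
      by rewrite !mul_row_col !mul1mx !mul0mx ?addr0 ?add0r.
  have Wd : W *m d = dx + constmx B2 *m du by rewrite mulmxDl -mulmxA Exd Eud.
  have Vd : V *m d = dy + constmx C2 *m db'.
    by rewrite mulmxDl -mulmxA -scalemxAl Eyd Ebd.
  have Hxd : Hx *m d = Pxx *m (dx + constmx B2 *m du) + Pxy *m (dy + constmx C2 *m db').
    by rewrite mulmxDl -!mulmxA Wd Vd.
  have Hud : (Hu - Eu) *m d
      = Pux *m (dx + constmx B2 *m du) + Puy *m (dy + constmx C2 *m db').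
    by rewrite addrK mulmxDl -!mulmxA Wd Vd.
  have Hbd : Hb *m d = zi *: (zsub A *m db' - constmx B2 *m ((Hu - Eu) *m d)).
    by rewrite -scalemxAl mulmxBl -!mulmxA -scalemxAl Ebd.
  have Hyd : Hy *m d = constmx C2 *m (Hx *m d) + dy by rewrite mulmxDl -mulmxA Eyd.
  have HuE : Hu *m d = (Hu - Eu) *m d + du by rewrite mulmxBl Eud subrK.
  rewrite !mul_col_mx Hbd Hyd HuE Hud Hxd.
  have := solve_implementation x (dx + constmx B2 *m du) (zvar R *: b - zsub A *m db')
    (u - du) (y + constmx C2 *m db') (dy + constmx C2 *m db') E1 E2 E3 E4.
  move: (dx + constmx B2 *m du) => w sol.
  (* Since [Pxx (zI - A) = I + Pxy C2], subtracting [(zI - A) db'] from [z b] removes [db'] and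
     shifts the measurement by [C2 db']. *)
  have eB : Pxx *m (zvar R *: b) = db' - Pxy *m y <->
      Pxx *m (zvar R *: b - zsub A *m db') = - (Pxy *m (y + constmx C2 *m db')).
    rewrite mulmxBr [Pxx *m (zsub A *m _)]mulmxA E3 mulmxDl mul1mx mulmxDr opprD.
    rewrite mulmxA opprD addrA.
    split=> [->|/addIr <-]; last by rewrite [RHS]addrC subrK.
    by rewrite [X in X - _ = _]addrAC subrr add0r.
  have eu : u - du = Pux *m (zvar R *: b) + Puy *m y <->
      u - du = Pux *m (zvar R *: b - zsub A *m db') + Puy *m (y + constmx C2 *m db').
    rewrite mulmxBr [Pux *m (zsub A *m _)]mulmxA E4 mulmxDr mulmxA addrA.
    by rewrite [X in _ <-> _ = X + _]addrAC subrK.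
  split=> [[H1 H2 /eB H3 /eu H4]|/eq_col_mx[Sx /eq_col_mx[Su /eq_col_mx[Sy Sb]]]].
    have [Sx Su _ Sb] := sol.1 (And4 H1 H2 H3 H4).
    have Ey' : y = constmx C2 *m x + dy.
      by apply: (addIr (constmx C2 *m db')); rewrite H2 addrA.
    have Eb' : zvar R *: b = zsub A *m db' - constmx B2 *m (u - du).
      by apply/eqP; rewrite addrC -subr_eq Sb.
    by rewrite -Sx -Su subrK -Ey' -Eb' scalerA mulVf // scale1r.
  have Eu' : u - du = Pux *m w + Puy *m (dy + constmx C2 *m db').
    by rewrite Su addrK.
  have [|H1 H2 /eB H3 /eu H4] := sol.2; last by split.
  split=> //; first by rewrite Sy -Sx addrA.
  by rewrite Sb scalerA divff // scale1r addrC addKr -Eu'.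
have szi a b (F : 'M[ratfun R]_(a, b)) : RHinf_mx F -> RHinf_mx (zi *: F).
  exact/RHinf_mxZ/RHinf_zinv.
have [sEx sEy sEu sEb] : [/\ RHinf_mx Ex, RHinf_mx Ey, RHinf_mx Eu & RHinf_mx Eb].
  by split; apply: RHinf_constmx.
have sW : RHinf_mx W by apply: RHinf_mxD => //; apply: RHinf_constmxM.
have sV : RHinf_mx V by apply: RHinf_mxD => //; apply/RHinf_constmxM/szi.
have sHx : RHinf_mx Hx by apply: RHinf_mxD; apply: RHinf_mxM => //; apply: zRHinf_mxW.
have sHu : RHinf_mx Hu.
  apply: RHinf_mxD => //; apply: RHinf_mxD; apply: RHinf_mxM => //.
  exact: zRHinf_mxW.
have sHy : RHinf_mx Hy by apply: RHinf_mxD => //; apply: RHinf_constmxM.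
suff sHb : RHinf_mx Hb by do 3!apply: RHinf_col_mx => //.
(* The improper factor [zI - A] is absorbed by the outer [1/z]: [I - A / z] is stable. *)
rewrite /Hb scalerBr scalemxAl; apply: RHinf_mxB; last first.
  by apply/szi/RHinf_constmxM/RHinf_mxB.
apply: RHinf_mxM; last exact: szi.
rewrite /zsub scalerBr scale_scalar_mx mulVf //.
by apply: RHinf_mxB; [apply/RHinf_scalar_mx/RHinf1 | apply/szi/RHinf_constmx].
Qed.

End Implementation.

Theorem theorem5p1 (R : realType) (n m p : nat)
    (A : 'M[R]_n) (B2 : 'M[R]_(n, m)) (C2 : 'M[R]_(p, n)) :
  (forall (Pxx : 'M[ratfun R]_n) (Pux : 'M[ratfun R]_(m, n))
          (Pxy : 'M[ratfun R]_(n, p)) (Puy : 'M[ratfun R]_(m, p)),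
      in_affine_subspace A B2 C2 Pxx Pux Pxy Puy <->
      exists K : 'M[ratfun R]_(m, p),
        internally_stabilizing A B2 C2 K
        /\ achieves A B2 C2 K Pxx Pux Pxy Puy)
  /\
  (forall (Pxx : 'M[ratfun R]_n) (Pux : 'M[ratfun R]_(m, n))
          (Pxy : 'M[ratfun R]_(n, p)) (Puy : 'M[ratfun R]_(m, p)),
      in_affine_subspace A B2 C2 Pxx Pux Pxy Puy ->
      [/\ Pxx \in unitmx,
          controller (Puy - Pux *m invmx Pxx *m Pxy),
          achieves A B2 C2 (Puy - Pux *m invmx Pxx *m Pxy) Pxx Pux Pxy Puy
        & implementation_internally_stable A B2 C2
            (zvar R *: (1%:M - zvar R *: Pxx))
            (zvar R *: Pux)
            (- (zvar R *: Pxy))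
            Puy]).
Proof.
split=> [Pxx Pux Pxy Puy|Pxx Pux Pxy Puy aff]; last first.
  have uP := Pxx_unit aff; have [eqs _ _] := (in_affine_subspaceE _ _ _ _ _ _ _).1 aff.
  have [ach _ _] := response_equations_achieves eqs uP.
  have [D HD] := response_controller_realizable aff.
  have [k [Ak [Bk [Ck HK]]]] := minimal_realization HD.
  split=> //; last exact: implementation_stable.
  split; first exact: realizable_proper HD.
  by exists k, Ak, Bk, Ck, D.
split=> [aff|[K [[_ [k [Ak [Bk [Ck [Dk [[HK _ _] sM]]]]]]] ach]]].
  have uP := Pxx_unit aff.
  have [eqs [sxx sux sxy] suy] := (in_affine_subspaceE _ _ _ _ _ _ _).1 aff.
  have [ach _ _] := response_equations_achieves eqs uP.
  have [D HD] := response_controller_realizable aff.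
  have [k [Ak [Bk [Ck HK]]]] := minimal_realization HD.
  exists (response_controller Pxx Pux Pxy Puy); split=> //.
  split; first exact: realizable_proper HD.
  exists k, Ak, Bk, Ck, D; split=> //.
  by apply: response_stabilizes HK ach _ _ _ suy; apply: zRHinf_mxW.
apply/in_affine_subspaceE.
have [sxxy suy] := stabilized_response HK sM ach.
by split=> //; apply: achieves_response_equations ach.
Qed.
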